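(* For each natural number $k$ there exists a polynomial $P_k(x_1,\dots,x_k)$ with rational coefficients such that for all $q\in\mathbb{C}$ with $|q|<1$ and all complex $a$ and nonzero complex $c$ with $|ac|<1$ and $|cq|<1$, $$\sum_{n=1}^\infty \frac{(q/a)_{n} a^{n}}{(1-cq^n)^{k+1} (q)_{n-1}}=-\frac{1}{c}\frac{(q)_\infty(ac)_\infty}{(cq)_\infty (a)_\infty} P_{k}\big(\mathfrak{S}_{0,a,c}(q),\mathfrak{S}_{1,a,c}(q), \dots, \mathfrak{S}_{k-1,a,c}(q)\big).$$
   Context: For $x\in\mathbb{C}$: $(x)_0=1$, $(x)_n=(1-x)(1-xq)\cdots(1-xq^{n-1})$, $(x)_\infty=\lim_{n\to\infty}(x)_n$. For a nonnegative integer $m$ and complex $c$, $\sigma_{m,c}(n)=\sum_{d\mid n}d^mc^d$. For $m\ge0$: $S_{m,c}(q)=\sum_{n=1}^\infty \frac{n^mc^nq^n}{1-q^n}=\sum_{n\ge1}\sigma_{m,c}(n)q^n$; $R_{m,ac}(q)=\mathrm{Li}_{-m}(ac)+\sum_{n=1}^\infty\frac{n^ma^nc^nq^n}{1-q^n}$, where $\mathrm{Li}_{-m}(z)=\sum_{n\ge1}n^mz^n$ is the polylogarithm; and $\mathfrak{S}_{m,a,c}(q)=S_{m,c}(q)-R_{m,ac}(q)$.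
   Formalization: The series on the left diverges when |a| ≥ 1 (e.g. q=0, a=2, c=1/4), so the identity is stated for those a for which the series converges, with convergence proved for |a|<1; at a=0 the product (q/a)_n a^n is read as its polynomial continuation, and k ≥ 1. *)

(* Defs.v *)
From HB Require Import structures.
From mathcomp Require Import all_boot all_order all_algebra.
From mathcomp Require Import boolp classical_sets reals topology normedtype sequences.
From mathcomp Require Import complex.
(* Not imported: the notations of mpoly clash with those of classical_sets. *)
From mathcomp Require mpoly.

Set Implicit Arguments.
Unset Strict Implicit.
Unset Printing Implicit Defensive.

Import Order.TTheory GRing.Theory Num.Theory.
Import numFieldNormedType.Exports.

Local Open Scope classical_set_scope.
Local Open Scope ring_scope.

(* The complex numbers; the topology on R[i] induced by the modulus is carried
   by the alias R[i]^o. *)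
Notation CC R := (complex R)^o (only parsing).

Section QSeries.
Variable R : realType.
Implicit Types (a c q x z : CC R) (m n k : nat) (u : nat -> CC R).

(* Partial sums and sum of \sum_(n >= 1) u n. *)
Definition series1 u : nat -> CC R := series (fun n => u n.+1).
Definition sum1 u : CC R := limn (series1 u).

Definition qpoch q x n : CC R := \prod_(i < n) (1 - x * q ^+ i).
Definition qpochoo q x : CC R := limn (qpoch q x).

(* (q/a)_n a^n, a polynomial in a; at a = 0 it takes its limit as a -> 0, see
   qpoch_divE. *)
Definition qpoch_div q a n : CC R :=
  if a == 0 then \prod_(i < n) (- q ^+ i.+1) else qpoch q (q / a) n * a ^+ n.

Lemma qpoch_divE q a n : qpoch_div q a n = \prod_(i < n) (a - q ^+ i.+1).
Proof.
rewrite /qpoch_div; case: eqP => [->|/eqP a0].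
  by apply: eq_bigr => i _; rewrite sub0r.
have -> : a ^+ n = \prod_(i < n) a by rewrite prodr_const card_ord.
rewrite /qpoch -big_split /=; apply: eq_bigr => i _.
by rewrite mulrBl mul1r mulrAC divfK// exprS.
Qed.

Definition Sser m c q : CC R :=
  sum1 (fun n => n%:R ^+ m * c ^+ n * q ^+ n / (1 - q ^+ n)).

(* The polylogarithm Li_(-m)(z), for |z| < 1. *)
Definition negLi m z : CC R := sum1 (fun n => n%:R ^+ m * z ^+ n).

Definition Rser m a c q : CC R :=
  negLi m (a * c)
  + sum1 (fun n => n%:R ^+ m * a ^+ n * c ^+ n * q ^+ n / (1 - q ^+ n)).

Definition frakS m a c q : CC R := Sser m c q - Rser m a c q.

Definition lhs_term k q a c n : CC R :=
  qpoch_div q a n / ((1 - c * q ^+ n) ^+ k.+1 * qpoch q q n.-1).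

(* The value of a rational polynomial in k variables at a point of C^k. *)
Definition evalQ k (P : mpoly.mpoly k rat) (v : 'I_k -> CC R) : CC R :=
  mpoly.mmap (ratr : rat -> CC R) v P.

End QSeries.

(* Main.v *)
(* For |a| < 1, expanding 1 / (1 - cq^n)^(k+1) into the negative binomial series and summing over n
   with the q-binomial theorem turns the left-hand side into -(K / c) G_k, where K = (q)_oo / (a)_oo,
   G_k = \sum_n C(n+k-1, k) g_n c^n and G(c) = \sum_n g_n c^n = (ac)_oo / (cq)_oo. Thus G_k is the
   coefficient of t^k in G(c / (1 - t)), and the logarithmic derivative in t of that function gives
   (k + 1) G_(k+1) = \sum_(j <= k) Y_j G_(k-j) with Y_j = \sum_n C(n+j, j) s_n c^n, where
   \sum_n s_n c^n = c G'(c) / G(c). Since C(n+j, j) is a rational polynomial in n of degree j and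
   the m-th function frakS is \sum_n n^m s_n c^n, Y_j is a rational combination of frakS_0, ...,
   frakS_j, and by induction G_k = G_0 P_k(frakS_0, ..., frakS_(k-1)). These identities
   amount to relations between the coefficients of c^n, so that no differentiation is needed. *)
Require Import Defs.
From mathcomp Require Import all_boot all_order all_algebra.
From mathcomp Require Import boolp classical_sets reals topology normedtype sequences.
From mathcomp Require Import complex.
From mathcomp Require mpoly.
From mathcomp Require Import ring lra zify.
Set Implicit Arguments.
Unset Strict Implicit.
Unset Printing Implicit Defensive.
Import Order.TTheory GRing.Theory Num.Theory.
Import numFieldNormedType.Exports.
Local Open Scope classical_set_scope.
Local Open Scope ring_scope.

(** * Bounds and a convolution formula for binomial coefficients *)

(** Each of the k factors (m + i) / i is at most m + 1. Such a polynomial bound lets binomial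
    weights preserve geometric decay. *)
Lemma bin_leX m k : ('C(m + k, k) <= m.+1 ^ k)%N.
Proof.
elim: k => [|k IH]; first by rewrite bin0.
rewrite addnS -(leq_pmul2l (ltn0Sn k)) -mul_bin_diag /= expnS.
apply: leq_trans (_ : (m.+1 * k.+1) * 'C(m + k, k) <= _)%N; last by rewrite mulnCA mulnA leq_pmul2l.
by rewrite leq_mul2r; apply/orP; right; nia.
Qed.

(* The coefficient of t^k in (1 - t)^-p, also for p = 0. *)
Definition mbin p k := 'C((p + k).-1, k).

(** Coefficient of t^k in (1 - t)^-p (1 - t)^-r = (1 - t)^-(p + r). The inner fact [rec] is Pascal's
    rule, that is, (1 - t)^-(p + 1) (1 - t) = (1 - t)^-p. *)
Lemma mbin_conv p r k : (\sum_(j < k.+1) mbin p j * mbin r (k - j) = mbin (p + r) k)%N.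
Proof.
elim: p k => [|p IHp] k.
  rewrite big_ord_recl subn0 big1 ?addn0 ?mul1n// => i _.
  by rewrite /mbin add0n /= bin_small.
have rec p' k' : mbin p'.+1 k'.+1 = (mbin p' k'.+1 + mbin p'.+1 k')%N.
  by rewrite /mbin addSn addnS /= binS.
elim: k => [|k IHk].
  by rewrite big_ord_recl big_ord0 /mbin !bin0.
rewrite addSn rec -addSn -IHk -IHp big_ord_recl [in RHS]big_ord_recl /=.
have -> : mbin p.+1 0 = mbin p 0 by rewrite /mbin !bin0.
rewrite -addnA; congr (_ + _)%N; rewrite -big_split /=; apply: eq_bigr => i _.
by rewrite rec mulnDl subSS.
Qed.

Lemma mbin_addr p k : mbin p.+1 k = 'C(p + k, k).
Proof. by []. Qed.

Lemma mbin_le p k : (mbin p k <= 'C(p + k, k))%N.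
Proof. by rewrite leq_bin2l// leq_pred. Qed.

(** By n + 2 <= 2 (n + 1), the bound is in powers of n + 1, the weights that [geo_natmulX]
    absorbs. *)
Lemma mbin_shift_le n j : (mbin n.+2 j <= 2 ^ j * n.+1 ^ j)%N.
Proof.
rewrite -expnMn; apply: leq_trans (bin_leX n.+1 j) _.
by case: j => // j; rewrite leq_exp2r// mulnS mul2n -addnn; lia.
Qed.

(** * Modulus and limits of complex numbers *)

Section ComplexSeries.
Variable R : realType.
Local Notation C := (complex R)^o.
Implicit Types (u v : nat -> C) (x y l : C).

(** The norm of [complex R] takes values in [complex R]; a real-valued modulus is what the estimates
    below can compare. *)
Definition cnorm (x : C) : R := Normc.normc x.

Lemma normC_cnorm x : `|x| = real_complex R (cnorm x).
Proof. by []. Qed.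

Lemma cnorm_ge0 x : 0 <= cnorm x.
Proof. by rewrite -ler0c; exact: (normr_ge0 (x : complex R)). Qed.

Lemma cnormM x y : cnorm (x * y) = cnorm x * cnorm y.
Proof. exact: Normc.normcM. Qed.

Lemma cnorm0 : cnorm 0 = 0.
Proof. exact: Normc.normc0. Qed.

Lemma cnorm1 : cnorm 1 = 1.
Proof. exact: Normc.normc1. Qed.

Lemma cnormV x : cnorm x^-1 = (cnorm x)^-1.
Proof. exact: Normc.normcV. Qed.

Lemma cnormX x n : cnorm (x ^+ n) = cnorm x ^+ n.
Proof.
by elim: n => [|n IH]; rewrite ?expr0 ?cnorm1// !exprS cnormM IH.
Qed.

Lemma cnormD x y : cnorm (x + y) <= cnorm x + cnorm y.
Proof. exact: le_normcD. Qed.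

Lemma cnormN x : cnorm (- x) = cnorm x.
Proof. exact: normcN. Qed.

Lemma cnormB x y : cnorm (x - y) <= cnorm x + cnorm y.
Proof. by rewrite -(cnormN y) cnormD. Qed.

Lemma cnorm_nat n : cnorm n%:R = n%:R.
Proof. by rewrite /cnorm -[1]/(1%C) normcMn Normc.normc1. Qed.

Lemma normC_lt1 x : (`|x| < 1) = (cnorm x < 1).
Proof. by rewrite normC_cnorm -(ltcR (cnorm x) 1). Qed.

Lemma cnorm_sum (I : Type) (r : seq I) (F : I -> C) :
  cnorm (\sum_(i <- r) F i) <= \sum_(i <- r) cnorm (F i).
Proof.
elim: r => [|i r IH]; first by rewrite !big_nil cnorm0.
by rewrite !big_cons (le_trans (cnormD _ _))// lerD2l.
Qed.

Lemma cvg_cnorm u l :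
  u @ \oo --> l <-> (fun n => cnorm (u n - l)) @ \oo --> (0 : R).
Proof.
split.
  move=> /cvgrPdist_lt h; apply/cvgrPdist_lt => e e0.
  have := h (real_complex R e); rewrite ltcR => /(_ e0); apply: filterS => n.
  rewrite normC_cnorm ltcR sub0r normrN ger0_norm ?cnorm_ge0//.
  by rewrite -cnormN opprB.
move=> /cvgrPdist_lt h; apply/cvgrPdist_lt => e e0.
(* A positive element of [complex R] has imaginary part 0, so the radius e is real. *)
have [er ei] : 0 < complex.Re e /\ (real_complex R (complex.Re e)) = e :> C.
  by case: e e0 => a b; rewrite ltcE /= => /andP[/eqP -> ->].
have := h _ er; apply: filterS => n.
rewrite sub0r normrN ger0_norm ?cnorm_ge0// => ?.
by rewrite -ei normC_cnorm ltcR -cnormN opprB.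
Qed.

Lemma cvg_cnorm0 u : (fun n => cnorm (u n)) @ \oo --> (0 : R) -> u @ \oo --> (0 : C).
Proof.
by move=> h; apply/cvg_cnorm; under eq_fun do rewrite subr0.
Qed.

Lemma cvg_exprC x : cnorm x < 1 -> (fun n => x ^+ n) @ \oo --> (0 : C).
Proof.
move=> x1; apply: cvg_cnorm0; under eq_fun do rewrite cnormX.
by apply: cvg_expr; rewrite ger0_norm ?cnorm_ge0.
Qed.

Lemma ler_Re_cnorm x : `|complex.Re x| <= cnorm x.
Proof. by rewrite -lecR; exact: normc_ge_Re. Qed.

Lemma ler_Im_cnorm x : `|complex.Im x| <= cnorm x.
Proof.
have := ler_Re_cnorm (x * ('i)%C); rewrite ReiNIm normrN cnormM.
by rewrite [cnorm ('i)%C]/cnorm /= expr0n/= expr1n add0r sqrtr1 mulr1.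
Qed.

Lemma cnorm_le_ReIm x : cnorm x <= `|complex.Re x| + `|complex.Im x|.
Proof.
case: x => a b; rewrite /cnorm /=.
rewrite -(ger0_norm (addr_ge0 (normr_ge0 a) (normr_ge0 b))) -sqrtr_sqr ler_wsqrtr//.
rewrite sqrrD !real_normK ?num_real// lerD2r lerDl.
by rewrite mulrn_wge0// mulr_ge0.
Qed.

(** * Geometrically dominated series *)

(** The convergence criterion used throughout. The case n = 0 forces M >= 0. *)
Definition geo (u : nat -> C) :=
  exists M rho : R, [/\ 0 <= rho, rho < 1 & forall n, cnorm (u n) <= M * rho ^+ n].

Lemma Re_series u n : complex.Re (series u n) = series (fun i => complex.Re (u i)) n.
Proof. by rewrite /series /=; elim/big_rec2: _ => // i a b _ <-; case: (u i) b => ? ? []. Qed.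

Lemma Im_series u n : complex.Im (series u n) = series (fun i => complex.Im (u i)) n.
Proof. by rewrite /series /=; elim/big_rec2: _ => // i a b _ <-; case: (u i) b => ? ? []. Qed.

Lemma dominated_cvg_series (u : nat -> R) (M rho : R) :
  0 <= rho -> rho < 1 -> (forall n, `|u n| <= M * rho ^+ n) -> cvgn (series u).
Proof.
move=> r0 r1 h; apply: normed_cvg.
apply: (@series_le_cvg _ _ (geometric M rho)) => //= [n|].
  by rewrite (le_trans _ (h n)).
by apply: is_cvg_geometric_series; rewrite ger0_norm.
Qed.

(** The real and imaginary parts are dominated by the same geometric series, and their sums form the
    complex limit. *)
Lemma geo_cvg u : geo u -> cvgn (series u).
Proof.
case=> M [rho [r0 r1 h]].
have hR : cvgn (series (fun i => complex.Re (u i))).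
  apply: (@dominated_cvg_series _ M rho) => // n.
  by rewrite (le_trans _ (h n))//; exact: ler_Re_cnorm.
have hI : cvgn (series (fun i => complex.Im (u i))).
  apply: (@dominated_cvg_series _ M rho) => // n.
  by rewrite (le_trans _ (h n))//; exact: ler_Im_cnorm.
set lR := limn (series (fun i => complex.Re (u i))) in hR.
set lI := limn (series (fun i => complex.Im (u i))) in hI.
apply/cvg_ex; exists (Complex lR lI); apply/cvg_cnorm.
apply: (@squeeze_cvgr _ _ _ _ (fun=> 0)
  (fun n => `|series (fun i => complex.Re (u i)) n - lR| +
            `|series (fun i => complex.Im (u i)) n - lI|)).
- apply: nearW => n; rewrite cnorm_ge0/= (le_trans (cnorm_le_ReIm _))//.
  by rewrite -Re_series -Im_series; case: (series u n).
- exact: cvg_cst.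
- rewrite -[X in _ --> X]addr0; apply: cvgD.
  + by apply/norm_cvg0P/subr_cvg0.
  + by apply/norm_cvg0P/subr_cvg0.
Qed.

Lemma cnorm_le_lim u l (B : R) : (forall n, cnorm (u n) <= B) -> u @ \oo --> l -> cnorm l <= B.
Proof.
move=> h /cvg_cnorm /cvgrPdist_lt hl; apply/ler_addgt0Pr => e e0.
have [n _ /(_ n (leqnn n))] := hl _ e0.
rewrite /= sub0r normrN ger0_norm ?cnorm_ge0// => hn.
have -> : l = u n - (u n - l) by ring.
by rewrite (le_trans (cnormB _ _))// lerD// ltW.
Qed.

Lemma cvgC_lim u l : u @ \oo --> l -> limn u = l.
Proof. by move=> h; apply: cvg_lim; [exact: norm_hausdorff | exact: h]. Qed.

Definition tsum u : C := limn (series u).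

Lemma seriesE u n : series u n = \sum_(i < n) u i.
Proof. by rewrite /series /= big_mkord. Qed.

Lemma seriesS u n : series u n.+1 = series u n + u n.
Proof. by rewrite !seriesE big_ord_recr. Qed.

Lemma geometric_sum_le (rho : R) n : 0 <= rho -> rho < 1 -> \sum_(i < n) rho ^+ i <= (1 - rho)^-1.
Proof.
move=> r0 r1; have p : 0 < 1 - rho by rewrite subr_gt0.
rewrite -[leRHS]mul1r ler_pdivlMr//.
have -> : (\sum_(i < n) rho ^+ i) * (1 - rho) = 1 - rho ^+ n.
  elim: n => [|n IH]; first by rewrite big_ord0 mul0r subrr.
  by rewrite big_ord_recr /= mulrDl IH exprS; ring.
by rewrite lerBlDr lerDl exprn_ge0.
Qed.

Lemma series_dom_le u (M rho : R) n : 0 <= rho -> rho < 1 ->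
  (forall i, cnorm (u i) <= M * rho ^+ i) -> cnorm (series u n) <= M / (1 - rho).
Proof.
move=> r0 r1 h; rewrite seriesE (le_trans (cnorm_sum _ _))//.
have M0 : 0 <= M by have := h 0%N; rewrite mulr1; exact/le_trans/cnorm_ge0.
apply: (@le_trans _ _ (\sum_(i < n) M * rho ^+ i)); first by apply: ler_sum.
by rewrite -mulr_sumr ler_wpM2l// geometric_sum_le.
Qed.

Lemma cvg_shift u l k : (fun n => u (k + n)%N) @ \oo --> l <-> u @ \oo --> l.
Proof.
split; last by apply: cvg_comp; apply: cvg_addnl.
move=> h; rewrite -(cvg_shiftn k).
by under eq_fun do rewrite addnC.
Qed.

Lemma tail_le u (M rho : R) L : 0 <= rho -> rho < 1 ->
  (forall i, cnorm (u i) <= M * rho ^+ i) ->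
  cnorm (tsum u - series u L) <= M / (1 - rho) * rho ^+ L.
Proof.
move=> r0 r1 h.
have cu : cvgn (series u) by apply: geo_cvg; exists M, rho.
apply: (@cnorm_le_lim (fun n => series u (L + n)%N - series u L)) => [n|].
  have -> : series u (L + n)%N - series u L = series (fun i => u (L + i)%N) n.
    by rewrite !seriesE big_split_ord /= addrAC subrr add0r.
  rewrite mulrAC; apply: series_dom_le => // i.
  by rewrite -mulrA -exprD.
apply: cvgB; last exact: cvg_cst.
by apply/(cvg_shift (series u)).
Qed.

(** Dominated convergence for series: beyond a cutoff L both tails are below e / 3 uniformly in N,
    and the head is a finite sum of limits. *)
Lemma tannery (a : nat -> nat -> C) (b : nat -> C) (M rho : R) :
  0 <= rho -> rho < 1 -> (forall N n, cnorm (a N n) <= M * rho ^+ n) ->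
  (forall n, (fun N => a N n) @ \oo --> b n) ->
  (fun N => tsum (a N)) @ \oo --> tsum b.
Proof.
move=> r0 r1 ha hab.
have hb n : cnorm (b n) <= M * rho ^+ n by apply: cnorm_le_lim (hab n) => N.
have hs L : (fun N => series (a N) L) @ \oo --> series b L.
  elim: L => [|L IH].
    under eq_fun do rewrite seriesE big_ord0.
    by rewrite seriesE big_ord0; exact: cvg_cst.
  under eq_fun do rewrite seriesS.
  rewrite seriesS; apply: cvgD; [exact: IH | exact: hab].
apply/cvg_cnorm/cvgrPdist_lt => e e0.
have ht : (fun L => M / (1 - rho) * rho ^+ L) @ \oo --> (0 : R).
  rewrite -(mulr0 (M / (1 - rho))); apply: cvgM; first exact: cvg_cst.
  by apply: cvg_expr; rewrite ger0_norm.
have e3 : 0 < e / 3 by rewrite divr_gt0.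
move/cvgrPdist_lt: ht => /(_ _ e3) [L _ /(_ L (leqnn L))].
rewrite /= sub0r normrN => /ltr_normlW hL.
have /cvg_cnorm/cvgrPdist_lt/(_ _ e3) := hs L; apply: filterS => N.
rewrite !sub0r !normrN !ger0_norm ?cnorm_ge0// => hN.
have -> : tsum (a N) - tsum b = (tsum (a N) - series (a N) L) +
  ((series (a N) L - series b L) - (tsum b - series b L)) by ring.
have h1 := tail_le L r0 r1 (ha N).
have h2 := tail_le L r0 r1 hb.
have h3 := cnormD (tsum (a N) - series (a N) L)
  ((series (a N) L - series b L) - (tsum b - series b L)).
have h4 := cnormB (series (a N) L - series b L) (tsum b - series b L).
lra.
Qed.

Lemma eq_tsum u v : (forall n, u n = v n) -> tsum u = tsum v.
Proof. by move=> /funext ->. Qed.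

Lemma tsumZ x u : cvgn (series u) -> tsum (fun n => x * u n) = x * tsum u.
Proof.
move=> cu; apply: cvgC_lim.
rewrite [X in X @ _ --> _](_ : _ = fun n => x * series u n); last first.
  by apply/funext => n; rewrite !seriesE mulr_sumr.
by apply: cvgM; [exact: cvg_cst | exact: cu].
Qed.

Lemma tsum_sum (b : nat -> nat -> C) N : (forall m, cvgn (series (b m))) ->
  tsum (fun n => \sum_(m < N) b m n) = \sum_(m < N) tsum (b m).
Proof.
move=> cb; apply: cvgC_lim.
rewrite [X in X @ _ --> _](_ : _ = fun n => \sum_(m < N) series (b m) n); last first.
  by apply/funext => n; rewrite seriesE exchange_big; apply: eq_bigr => m _; rewrite seriesE.
elim: N => [|N IH].
  by under eq_fun do rewrite big_ord0; rewrite big_ord0; exact: cvg_cst.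
under eq_fun do rewrite big_ord_recr.
by rewrite big_ord_recr; apply: cvgD; [exact: IH | exact: cb].
Qed.

Lemma tsum_finite u N : (forall n, (N <= n)%N -> u n = 0) -> tsum u = \sum_(i < N) u i.
Proof.
move=> h; apply: cvgC_lim.
apply/(cvg_shift _ _ N).
rewrite [X in X @ _ --> _](_ : _ = fun=> \sum_(i < N) u i); first exact: cvg_cst.
apply/funext => n; rewrite seriesE big_split_ord /= [X in _ + X]big1 ?addr0// => i _.
by rewrite h// leq_addr.
Qed.

Lemma tsumB u v : cvgn (series u) -> cvgn (series v) ->
  tsum (fun n => u n - v n) = tsum u - tsum v.
Proof.
move=> cu cv; apply: cvgC_lim.
rewrite [X in X @ _ --> _](_ : _ = fun n => series u n - series v n); first exact: (cvgB cu cv).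
by apply/funext => n; rewrite !seriesE sumrB.
Qed.

Lemma tsumD u v : cvgn (series u) -> cvgn (series v) ->
  tsum (fun n => u n + v n) = tsum u + tsum v.
Proof.
move=> cu cv; apply: cvgC_lim.
rewrite [X in X @ _ --> _](_ : _ = fun n => series u n + series v n); first exact: (cvgD cu cv).
by apply/funext => n; rewrite !seriesE big_split.
Qed.

Lemma tsum_recl u : cvgn (series u) -> tsum u = u 0%N + tsum (fun n => u n.+1).
Proof.
move=> cu; apply/eqP; rewrite addrC -subr_eq; apply/eqP/esym; apply: cvgC_lim.
rewrite [X in X @ _ --> _](_ : _ = fun n => series u n.+1 - u 0%N).
  by apply: cvgB; [apply/(cvg_shift _ _ 1%N); exact: cu | exact: cvg_cst].
by apply/funext => n; rewrite !seriesE big_ord_recl /= addrC addKr.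
Qed.

(** The partial sums over m are dominated in n uniformly, so [tannery] moves their limit inside the
    sum over n. *)
Lemma tsum_exchange (b : nat -> nat -> C) (M rho rho' : R) :
  0 <= rho -> rho < 1 -> 0 <= rho' -> rho' < 1 ->
  (forall n m, cnorm (b n m) <= M * rho ^+ n * rho' ^+ m) ->
  tsum (fun n => tsum (b n)) = tsum (fun m => tsum (fun n => b n m)).
Proof.
move=> r0 r1 r0' r1' h; apply/esym/cvgC_lim.
rewrite [X in X @ _ --> _](_ : _ = fun N => tsum (fun n => series (b n) N)); last first.
  apply/funext => N; rewrite seriesE -(@tsum_sum (fun m n => b n m)).
    by apply: eq_tsum => n; rewrite seriesE.
  move=> m; apply: geo_cvg; exists (M * rho' ^+ m), rho; split => // n.
  by rewrite mulrAC.
apply: (@tannery _ _ (M / (1 - rho')) rho r0 r1) => [N n|n].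
  by rewrite mulrAC; apply: series_dom_le.
by apply: geo_cvg; exists (M * rho ^+ n), rho'.
Qed.

(** * Cauchy products and stability of geometric domination *)

Definition conv u v n : C := \sum_(i < n.+1) u i * v (n - i)%N.

Lemma series_conv u v n : series (conv u v) n = \sum_(i < n) u i * series v (n - i)%N.
Proof.
elim: n => [|n IH]; first by rewrite !seriesE !big_ord0.
rewrite seriesS IH /conv big_ord_recr [RHS]big_ord_recr /= addrA -big_split /=.
congr (_ + _); last by rewrite subnn subSnn seriesS seriesE big_ord0 add0r.
by apply: eq_bigr => i _; rewrite subSn 1?ltnW// seriesS mulrDr.
Qed.

Lemma cvg_conv u v : geo u -> geo v -> series (conv u v) @ \oo --> tsum u * tsum v.
Proof.
move=> gu gv; have cu := geo_cvg gu; have cv := geo_cvg gv.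
have -> : tsum u * tsum v = tsum (fun n => u n * tsum v).
  by rewrite mulrC -(tsumZ _ cu); apply: eq_tsum => n; rewrite mulrC.
(* Truncated subtraction makes the terms with n >= N vanish, so the finite sum is a full series and
   [tannery] applies. *)
rewrite [X in X @ _ --> _](_ : _ = fun N => tsum (fun n => u n * series v (N - n)%N)); last first.
  apply/funext => N; rewrite series_conv (@tsum_finite _ N)// => n Nn.
  by rewrite (eqP (_ : (N - n)%N == 0%N)) ?subn_eq0// seriesE big_ord0 mulr0.
case: gu => [M [rho [r0 r1 hu]]]; case: gv => [M' [rho' [r0' r1' hv]]].
apply: (@tannery _ _ (M * (M' / (1 - rho'))) rho r0 r1) => [N n|n].
  by rewrite cnormM mulrAC; apply: ler_pM; rewrite ?cnorm_ge0//; apply: series_dom_le.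
apply: cvgM; first exact: cvg_cst.
apply/(cvg_shift _ _ n); under eq_fun do rewrite addKn; exact: cv.
Qed.

Lemma tsum_conv u v : geo u -> geo v -> tsum (conv u v) = tsum u * tsum v.
Proof. by move=> gu gv; exact/cvgC_lim/cvg_conv. Qed.

Lemma geo_le u v (B : R) : geo v -> 0 <= B -> (forall n, cnorm (u n) <= B * cnorm (v n)) -> geo u.
Proof.
case=> [M [rho [r0 r1 h]]] B0 huv; exists (B * M), rho; split => // n.
by rewrite (le_trans (huv n))// -mulrA ler_wpM2l.
Qed.

Lemma geoZ x u : geo u -> geo (fun n => x * u n).
Proof.
by move=> gu; apply: (geo_le gu (cnorm_ge0 x)) => n; rewrite cnormM.
Qed.

Lemma geo_shift u : geo u -> geo (fun n => u n.+1).
Proof.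
case=> [M [rho [r0 r1 h]]]; exists (M * rho), rho; split => // n.
by rewrite -mulrA -exprS.
Qed.

Lemma geo_expr x : cnorm x < 1 -> geo (fun n => x ^+ n).
Proof.
move=> x1; exists 1, (cnorm x); split; rewrite ?cnorm_ge0// => n.
by rewrite cnormX mul1r.
Qed.

(* With r the square root of rho, (n+1) rho^n is (n+1) r^n <= 1 + r + ... + r^n times r^n. *)
Lemma geo_natmul u : geo u -> geo (fun n => n.+1%:R * u n).
Proof.
case=> [M [rho [r0 r1 h]]].
have M0 : 0 <= M by have := h 0%N; rewrite mulr1; exact/le_trans/cnorm_ge0.
pose r := Num.sqrt rho; have rr : rho = r * r by rewrite -expr2 sqr_sqrtr.
have r0' : 0 <= r by apply: sqrtr_ge0.
have r1' : r < 1 by rewrite -sqrtr1 ltr_sqrt.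
exists (M / (1 - r)), r; split => // n.
rewrite cnormM cnorm_nat (le_trans (ler_wpM2l (ler0n _ _) (h n)))//.
rewrite rr exprMn [leLHS]mulrCA -[leRHS]mulrA ler_wpM2l// mulrA ler_wpM2r ?exprn_ge0//.
apply: le_trans (geometric_sum_le n.+1 r0' r1').
rewrite mulr_natl -[X in _ *+ X]card_ord -sumr_const ler_sum// => i _.
by rewrite ler_wiXn2l// ?ltW// -ltnS.
Qed.

Lemma geo_natmulX u m : geo u -> geo (fun n => n.+1%:R ^+ m * u n).
Proof.
move=> gu; elim: m => [|m IH]; first by under eq_fun do rewrite expr0 mul1r.
by under eq_fun do rewrite exprS -mulrA; exact: geo_natmul.
Qed.

(** The ratio test, giving a bound from n = 0 on. *)
Lemma geo_ratio u (r : nat -> C) l : r @ \oo --> l -> cnorm l < 1 ->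
  (forall n, u n.+1 = r n * u n) -> geo u.
Proof.
move=> /cvg_cnorm /cvgrPdist_lt hr l1 hu.
(* The midpoint of |l| and 1 exceeds the modulus of the ratios from some n0 on. *)
pose rho := (1 + cnorm l) / 2; have l0 := cnorm_ge0 l.
have r0 : 0 < rho by rewrite /rho; lra.
have r1 : rho < 1 by rewrite /rho; lra.
have [|n0 _ hn0] := hr (rho - cnorm l); first by rewrite /rho; lra.
(* M dominates |u_i| / rho^i for all i <= n0, which covers the initial terms. *)
pose M := \sum_(i < n0.+1) cnorm (u i) / rho ^+ i.
exists M, rho; split; rewrite ?(ltW r0)// => n.
have [nn0|/ltnW] := leqP n n0.
  rewrite -ler_pdivrMr ?exprn_gt0// /M.
  rewrite (bigD1 (Ordinal (nn0 : n < n0.+1)%N)) //= lerDl sumr_ge0// => i _.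
  by rewrite divr_ge0 ?cnorm_ge0// exprn_ge0// ltW.
elim: n => [|n IH].
  rewrite leqn0 => /eqP n00; rewrite /M n00 big_ord_recl big_ord0 addr0.
  by rewrite expr0 divr1 mulr1.
rewrite leq_eqVlt => /orP[/eqP n0E|nn0].
  rewrite -ler_pdivrMr ?exprn_gt0// /M n0E big_ord_recr /= lerDr sumr_ge0// => i _.
  by rewrite divr_ge0 ?cnorm_ge0// exprn_ge0// ltW.
rewrite hu cnormM exprS mulrCA ler_pM ?cnorm_ge0 ?IH//.
have := hn0 n nn0; rewrite /= sub0r normrN ger0_norm ?cnorm_ge0// => h.
have := cnormD (r n - l) l; rewrite subrK; lra.
Qed.

Lemma geoD u v : geo u -> geo v -> geo (fun n => u n + v n).
Proof.
move=> [M [r [r0 r1 h]]] [M' [r' [r0' r1' h']]].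
have M0 : 0 <= M by have := h 0%N; rewrite mulr1; exact/le_trans/cnorm_ge0.
have M0' : 0 <= M' by have := h' 0%N; rewrite mulr1; exact/le_trans/cnorm_ge0.
exists (M + M'), (Num.max r r'); split => [||n].
- by rewrite le_max r0.
- by rewrite gt_max r1.
rewrite (le_trans (cnormD _ _))// mulrDl; apply: lerD.
  apply: le_trans (h n) _; apply: ler_wpM2l => //.
  by apply: lerXn2r; rewrite ?nnegrE ?le_max ?r0 ?lexx.
apply: le_trans (h' n) _; apply: ler_wpM2l => //.
by apply: lerXn2r; rewrite ?nnegrE ?le_max ?r0' ?lexx ?orbT.
Qed.

Lemma geoB u v : geo u -> geo v -> geo (fun n => u n - v n).
Proof.
move=> gu /(geoZ (-1)) gv; have := geoD gu gv.
by under eq_fun do rewrite mulN1r.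
Qed.

Lemma subr1_neq0 x : cnorm x < 1 -> 1 - x != 0.
Proof.
move=> x1; rewrite subr_eq0; apply/eqP => x1E.
by move: x1; rewrite -x1E cnorm1 ltxx.
Qed.

Lemma geo_bin (u : nat -> C) k : geo u -> geo (fun m => 'C(m + k, k)%:R * u m).
Proof.
move=> gu; apply: (geo_le (geo_natmulX k gu) ler01) => m.
rewrite mul1r !cnormM cnormX !cnorm_nat -natrX ler_wpM2r ?cnorm_ge0// ler_nat.
exact: bin_leX.
Qed.

(** Induction on k, multiplying by the geometric series each time. *)
Lemma tsum_negbin (z : C) k : cnorm z < 1 ->
  tsum (fun m => 'C(m + k, k)%:R * z ^+ m) = (1 - z) ^- k.+1.
Proof.
move=> z1; have gz := geo_expr z1; have z0 := subr1_neq0 z1.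
have h0 : tsum (fun m => z ^+ m) = (1 - z)^-1.
  apply: (mulfI z0); rewrite divff// mulrBl mul1r -tsumZ; last exact: geo_cvg.
  rewrite {1}tsum_recl; last exact: geo_cvg.
  rewrite expr0 -[RHS]addr0 -addrA; congr (_ + _).
  by rewrite -(eq_tsum (fun n => exprS z n)) subrr.
elim: k => [|k IH].
  by rewrite expr1 -h0; apply: eq_tsum => m; rewrite bin0 mul1r.
rewrite exprS invfM -h0 mulrC -IH -tsum_conv//; last exact: geo_bin.
apply: eq_tsum => m; rewrite /conv.
(* The hockey-stick identity gives the coefficients of this Cauchy product. *)
have -> : 'C(m + k.+1, k.+1) = (\sum_(i < m.+1) 'C(i + k, k))%N.
  elim: m => [|m IHm]; first by rewrite big_ord_recl big_ord0 !add0n !binn.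
  by rewrite big_ord_recr /= -IHm addSn binS addSnnS.
rewrite natr_sum mulr_suml; apply: eq_bigr => i _.
by rewrite -mulrA -exprD subnKC// -ltnS.
Qed.

Lemma geo_mbin (u : nat -> C) k : geo u -> geo (fun n => (mbin n k)%:R * u n).
Proof.
move=> gu; apply: (geo_le (geo_bin k gu) ler01) => n.
by rewrite mul1r !cnormM !cnorm_nat ler_wpM2r ?cnorm_ge0// ler_nat mbin_le.
Qed.

Lemma cnorm_inv_subr1 (z : C) (r : R) : cnorm z <= r -> r < 1 -> cnorm (1 - z)^-1 <= (1 - r)^-1.
Proof.
move=> zr r1; have z1 := le_lt_trans zr r1.
have := cnormD (1 - z) z; rewrite subrK cnorm1 => h.
have hz := cnorm_ge0 (1 - z).
rewrite cnormV lef_pV2 ?posrE; lra.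
Qed.

End ComplexSeries.

(** * The q-binomial theorem *)

Section QBinomial.
Variable R : realType.
Local Notation C := (complex R)^o.
Variable q : C.
Hypothesis q1 : cnorm q < 1.
Implicit Types (x y a c : C).

Lemma cnorm_expr_lt1 x n : cnorm x < 1 -> cnorm (x * q ^+ n) < 1.
Proof.
move=> x1; rewrite cnormM cnormX (le_lt_trans _ x1)// ler_piMr ?cnorm_ge0//.
by rewrite exprn_ile1 ?cnorm_ge0// ltW.
Qed.

Lemma qpochS x n : qpoch q x n.+1 = qpoch q x n * (1 - x * q ^+ n).
Proof. by rewrite /qpoch big_ord_recr. Qed.

Lemma qpochD x m n : qpoch q x (m + n) = qpoch q x m * qpoch q (x * q ^+ m) n.
Proof.
rewrite /qpoch big_split_ord; congr (_ * _); apply: eq_bigr => i _ /=.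
by rewrite exprD mulrA.
Qed.

Lemma qpoch_neq0 x n : cnorm x < 1 -> qpoch q x n != 0.
Proof.
by move=> x1; apply/prodf_neq0 => i _; rewrite subr1_neq0// cnorm_expr_lt1.
Qed.

Lemma qq_neq0 n : 1 - q ^+ n.+1 != 0.
Proof. by rewrite exprS subr1_neq0// cnorm_expr_lt1. Qed.

(* The n-th term (y/x)_n x^n / (q)_n of the q-binomial series, polynomial in x and y. *)
Definition qbin x y n : C := (\prod_(i < n) (x - y * q ^+ i)) / qpoch q q n.

Lemma qbin0 x y : qbin x y 0 = 1.
Proof. by rewrite /qbin /qpoch !big_ord0 divr1. Qed.

Lemma qbinS x y n : qbin x y n.+1 = (x - y * q ^+ n) / (1 - q ^+ n.+1) * qbin x y n.
Proof.
rewrite /qbin big_ord_recr qpochS /= -exprS.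
have h1 := qq_neq0 n; have h2 := qpoch_neq0 n q1.
by field; rewrite h1 h2.
Qed.

(** Homogeneity moves powers of c and of q between the parameters and the terms. *)
Lemma qbin_scale z x y n : qbin (z * x) (z * y) n = z ^+ n * qbin x y n.
Proof.
elim: n => [|n IH]; first by rewrite !qbin0 mulr1.
by rewrite !qbinS IH [z ^+ n.+1]exprS; have h1 := qq_neq0 n; field.
Qed.

Lemma cvg_exprq : (fun n => q ^+ n) @ \oo --> (0 : C).
Proof. exact: cvg_exprC. Qed.

Lemma geo_qbin x y : cnorm x < 1 -> geo (qbin x y).
Proof.
move=> x1; apply: (geo_ratio _ x1 (qbinS x y)).
rewrite -[X in _ --> X]divr1.
apply: cvgM.
  rewrite -[X in _ --> X]subr0; apply: cvgB; first exact: cvg_cst.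
  rewrite -(mulr0 y); apply: cvgM; [exact: cvg_cst | exact: cvg_exprq].
apply: cvgV; first by rewrite oner_eq0.
rewrite -[X in _ --> X]subr0; apply: cvgB; first exact: cvg_cst.
by apply/(cvg_shift _ _ 1%N); exact: cvg_exprq.
Qed.

Definition qbsum x y : C := tsum (qbin x y).

(** The difference of the two sums has terms (1 - q^n) u_n, which [qbinS] turns into (x - y q^(n -
    1)) u_(n - 1). *)
Lemma qbsum_step x y : cnorm x < 1 ->
  (1 - x) * qbsum x y = (1 - y) * qbsum (q * x) (q * y).
Proof.
move=> x1; have g := geo_qbin y x1.
have g' : geo (qbin (q * x) (q * y)).
  by apply: geo_qbin; have := cnorm_expr_lt1 1 x1; rewrite expr1 mulrC.
have c := geo_cvg g; have c' := geo_cvg g'.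
have : qbsum x y - qbsum (q * x) (q * y) = x * qbsum x y - y * qbsum (q * x) (q * y).
  rewrite /qbsum -tsumB// tsum_recl; last first.
    exact/geo_cvg/geoB.
  rewrite !qbin0 subrr add0r -!tsumZ// -tsumB; last 2 first.
  - exact/geo_cvg/geoZ.
  - exact/geo_cvg/geoZ.
  apply: eq_tsum => n; rewrite !qbin_scale qbinS.
  by have h1 := qq_neq0 n; rewrite exprS in h1 *; field.
move/eqP; rewrite -subr_eq0 => /eqP h; apply/eqP; rewrite -subr_eq0 -h; apply/eqP; ring.
Qed.

Lemma qbsum_iter x y n : cnorm x < 1 ->
  qpoch q x n * qbsum x y = qpoch q y n * qbsum (q ^+ n * x) (q ^+ n * y).
Proof.
move=> x1; elim: n => [|n IH]; first by rewrite /qpoch !big_ord0 !mul1r.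
have h : cnorm (q ^+ n * x) < 1 by rewrite mulrC cnorm_expr_lt1.
have := qbsum_step (q ^+ n * y) h; rewrite !mulrA -exprS => hs.
rewrite !qpochS mulrAC IH -[RHS]mulrA [y * _]mulrC -hs; ring.
Qed.

(** As both parameters shrink to 0, only the constant term survives. *)
Lemma qbsum_cvg1 x y : cnorm x < 1 ->
  (fun n => qbsum (q ^+ n * x) (q ^+ n * y)) @ \oo --> (1 : C).
Proof.
move=> x1; have [M [r [r0 r1 h]]] := geo_qbin y x1.
have -> : 1 = tsum (fun n => (n == 0%N)%:R) :> C.
  by rewrite (@tsum_finite _ _ 1%N) ?big_ord1// => -[].
apply: (@tannery _ _ _ M r r0 r1) => [N n|n].
  rewrite qbin_scale cnormM (le_trans _ (h n))// ler_piMl ?cnorm_ge0//.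
  by rewrite -exprM cnormX exprn_ile1 ?cnorm_ge0// ltW.
under eq_fun do rewrite qbin_scale.
case: n => [|n]; first by under eq_fun do rewrite qbin0 expr0 mulr1; exact: cvg_cst.
have -> : (n.+1 == 0%N)%:R = 0 * qbin x y n.+1 :> C by rewrite mul0r.
apply: cvgM; last exact: cvg_cst.
under eq_fun do rewrite -exprM mulnC exprM.
by apply: cvg_exprC; rewrite exprS cnorm_expr_lt1.
Qed.

(** At y = 0 the iterated equation shows that (x)_n [qbsum x 0] tends to 1, which yields both the
    convergence of the infinite product and its non-vanishing. *)
Lemma qbsum_qpoch x : cnorm x < 1 -> qbsum x 0 * qpochoo q x = 1 /\ cvgn (qpoch q x).
Proof.
move=> x1; have qp0 n : qpoch q 0 n = 1.
  by rewrite /qpoch big1// => i _; rewrite mul0r subr0.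
have h : (fun n => qpoch q x n * qbsum x 0) @ \oo --> (1 : C).
  under eq_fun do rewrite qbsum_iter// qp0 mul1r.
  exact: qbsum_cvg1.
have n0 : qbsum x 0 != 0.
  apply/eqP => n0; move: h; under eq_fun do rewrite n0 mulr0.
  move=> /cvgC_lim; rewrite (cvgC_lim (cvg_cst _)).
  by move/eqP; rewrite eq_sym oner_eq0.
have h' : qpoch q x @ \oo --> (qbsum x 0)^-1.
  rewrite -[X in _ --> X]mul1r.
  rewrite [X in X @ _ --> _](_ : _ = fun n => qpoch q x n * qbsum x 0 * (qbsum x 0)^-1).
    by apply: cvgM; [exact: h | exact: cvg_cst].
  by apply/funext => n; rewrite mulfK.
split; last by apply/cvg_ex; exists (qbsum x 0)^-1.
by rewrite /qpochoo (cvgC_lim h') divff.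
Qed.

Lemma qpochoo_neq0 x : cnorm x < 1 -> qpochoo q x != 0.
Proof.
move=> x1; have [h _] := qbsum_qpoch x1; apply/eqP => h0.
by move: h; rewrite h0 mulr0 => /eqP; rewrite eq_sym oner_eq0.
Qed.

Lemma cvg_qpoch x : cnorm x < 1 -> qpoch q x @ \oo --> qpochoo q x.
Proof. by case/qbsum_qpoch. Qed.

(** The q-binomial theorem, by comparing the limits of the two sides of [qbsum_iter]. *)
Lemma qbsumE x y : cnorm x < 1 -> cnorm y < 1 -> qbsum x y = qpochoo q y / qpochoo q x.
Proof.
move=> x1 y1; apply: (canRL (mulfK (qpochoo_neq0 x1))); rewrite mulrC.
have h1 : (fun n => qpoch q x n * qbsum x y) @ \oo --> qpochoo q x * qbsum x y.
  by apply: cvgM; [exact: cvg_qpoch | exact: cvg_cst].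
have h2 : (fun n => qpoch q x n * qbsum x y) @ \oo --> qpochoo q y * 1.
  under eq_fun do rewrite qbsum_iter//.
  by apply: cvgM; [exact: cvg_qpoch | exact: qbsum_cvg1].
by rewrite -(cvgC_lim h1) (cvgC_lim h2) mulr1.
Qed.

Lemma qpochoo_shift x m : cnorm x < 1 -> qpochoo q x = qpoch q x m * qpochoo q (x * q ^+ m).
Proof.
move=> x1; apply: cvgC_lim; apply/(cvg_shift _ _ m).
under eq_fun do rewrite qpochD.
by apply: cvgM; [exact: cvg_cst | apply: cvg_qpoch; exact: cnorm_expr_lt1].
Qed.

End QBinomial.

(** * Logarithmic derivative of G and summation over n *)

Section LogDerivative.
Variable R : realType.
Local Notation C := (complex R)^o.
Variable q : C.
Hypothesis q1 : cnorm q < 1.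
Implicit Types (x y a c : C).

(** Coefficient of c^n in q G(c) = q (1 - ac) G(qc) / (1 - qc); the division by 1 - qc produces the
    partial sums. *)
Lemma sum_qbin a n :
  q ^+ n.+1 * (\sum_(i < n.+1) qbin q q a i) - a * q ^+ n * (\sum_(i < n) qbin q q a i)
  = q * qbin q q a n.
Proof.
elim: n => [|n IH].
  by rewrite big_ord_recl !big_ord0 qbin0 expr1; ring.
rewrite big_ord_recr [X in _ - _ * X]big_ord_recr /=.
rewrite !mulrDr opprD addrACA exprS -!mulrA [a * _]mulrCA.
have -> : q ^+ n.+1 * (a * \sum_(i < n) qbin q q a i) = q * (a * q ^+ n * \sum_(i < n) qbin q q a i).
  by rewrite exprS; ring.
rewrite -mulrBr IH qbinS//.
by have h1 := qq_neq0 q1 n; rewrite exprS in h1 *; field.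
Qed.

(** The factors 1 - a c q^i and 1 - c q^(i + 1) of (ac)_oo / (cq)_oo contribute q^((i + 1) n) - a^n
    q^(i n); this is their sum over i for n >= 1. *)
Definition ldcoef a n : C := (q ^+ n - a ^+ n) / (1 - q ^+ n).

(** By [qbinS], (n + 1) g_(n + 1) satisfies this recursion. For the convolution it holds term by
    term up to multiples of g and a telescoping difference of t. *)
Lemma conv_ldcoef_rec a n :
  (1 - q ^+ n.+2) * conv (fun i => ldcoef a i.+1) (qbin q q a) n.+1 =
  (q - a * q ^+ n.+1) * (conv (fun i => ldcoef a i.+1) (qbin q q a) n + qbin q q a n.+1).
Proof.
pose g := qbin q q a; pose t i := a ^+ i.+1 * q ^+ (n.+1 - i) * g (n.+1 - i)%N.
have term i : (i <= n)%N -> (1 - q ^+ n.+2) * (ldcoef a i.+1 * g (n.+1 - i)%N) =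
  (q - a * q ^+ n.+1) * (ldcoef a i.+1 * g (n - i)%N) - a * q ^+ n.+1 * g (n - i)%N
  + q ^+ n.+2 * g (n.+1 - i)%N + (t i.+1 - t i).
  (* Writing n = i + j removes truncated subtraction before [field]. *)
  move=> iN; have [j nij] : exists j, n = (i + j)%N by exists (n - i)%N; rewrite subnKC.
  rewrite /t subSS nij -addnS !addKn /g qbinS// /ldcoef.
  have h1 := qq_neq0 q1 i; have h2 := qq_neq0 q1 j.
  rewrite -!addnS !exprD; rewrite !exprS in h1 h2 *; field.
  by rewrite h1 h2.
have tele m : \sum_(i < m) t i.+1 = t m - t 0%N + \sum_(i < m) t i.
  by elim: m => [|m IH]; rewrite ?big_ord0 ?subrr ?add0r// !big_ord_recr /= IH; ring.
have rv (F : nat -> C) m : \sum_(i < m.+1) F (m - i)%N = \sum_(i < m.+1) F i.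
  by rewrite [RHS](reindex_inj rev_ord_inj); apply: eq_bigr => i _ /=; rewrite subSS.
rewrite /conv big_ord_recr mulrDr mulr_sumr (eq_bigr _ (fun (i : 'I_n.+1) _ => term i (leq_ord i))) /=.
rewrite !big_split /= tele !sumrN -!mulr_sumr.
rewrite (rv g n).
(* The two leftover sums of g, completed by the term g_0, collapse to q g_(n + 1). *)
have := sum_qbin a n.+1; rewrite -(rv (qbin q q a) n.+1) big_ord_recr /= -/g => hs.
rewrite subnn [g 0%N]qbin0 in hs *; rewrite /t subnn subn0 [g 0%N]qbin0 /ldcoef.
have h1 := qq_neq0 q1 n.+1.
have -> : (1 - q ^+ n.+2) * ((q ^+ n.+2 - a ^+ n.+2) / (1 - q ^+ n.+2) * 1) =
  q ^+ n.+2 - a ^+ n.+2 by field.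
rewrite [RHS]mulrDr [X in _ = _ + X]mulrBl -hs; ring.
Qed.

(* [qbin q q a] is the coefficient sequence of G(c) = (ac)_oo / (cq)_oo and [ldcoef a] that of
   c G'(c) / G(c), so both sides are coefficients of c G'(c). *)
Lemma conv_ldcoef a n :
  conv (fun i => ldcoef a i.+1) (qbin q q a) n = n.+1%:R * qbin q q a n.+1.
Proof.
elim: n => [|n IH].
  rewrite /conv big_ord_recl big_ord0 subn0 qbin0 qbinS// qbin0 /ldcoef.
  by rewrite expr0 !expr1; ring.
have h1 := qq_neq0 q1 n.+1.
apply: (mulfI h1); rewrite conv_ldcoef_rec IH [qbin q q a n.+2]qbinS//.
by rewrite [n.+2%:R]mulrS; field.
Qed.

(* [lhs_term] without its dependence on c. *)
Definition uterm a n : C := qpoch_div q a n / qpoch q q n.-1.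

(** Splitting off a - q leaves a q-binomial term, so [qbsumE] can sum over n. *)
Lemma utermS a n : uterm a n.+1 = (a - q) * qbin q a (q ^+ 2) n.
Proof.
rewrite /uterm qpoch_divE /= big_ord_recl expr1 /qbin -mulrA.
congr (_ * (_ / _)); apply: eq_bigr => i _.
by rewrite -exprD.
Qed.

Lemma geo_uterm a : cnorm a < 1 -> geo (fun n => uterm a n.+1).
Proof.
by move=> a1; under eq_fun do rewrite utermS; apply/geoZ/geo_qbin.
Qed.

(** The factor q^((n + 1) m) rescales the parameters to a q^m and q^(m + 2). Shifting the infinite
    products leaves (a)_m / (q)_(m + 1), and (a - q) q^m (a)_m is minus the numerator of
    [qbin q q a m.+1]. *)
Lemma tsum_uterm a m : cnorm a < 1 ->
  tsum (fun n => uterm a n.+1 * (q ^+ n.+1) ^+ m) =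
  - (qpochoo q q / qpochoo q a * qbin q q a m.+1).
Proof.
move=> a1.
have am : cnorm (a * q ^+ m) < 1 by exact: cnorm_expr_lt1.
have qm : cnorm (q * q ^+ m.+1) < 1 by exact: cnorm_expr_lt1.
have -> : tsum (fun n => uterm a n.+1 * (q ^+ n.+1) ^+ m) =
   (a - q) * q ^+ m * qbsum q (a * q ^+ m) (q * q ^+ m.+1).
  rewrite -tsumZ; last exact/geo_cvg/geo_qbin.
  apply: eq_tsum => n; rewrite utermS.
  have -> : q * q ^+ m.+1 = q ^+ m * q ^+ 2 by rewrite exprS; ring.
  rewrite [a * _]mulrC qbin_scale// -exprM mulSn exprD exprM -!exprM [(n * m)%N]mulnC; ring.
rewrite qbsumE// (qpochoo_shift q1 m a1) (qpochoo_shift q1 m.+1 q1) /qbin big_ord_recl /=.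
have -> : \prod_(i < m) (q - a * q ^+ i.+1) = q ^+ m * qpoch q a m.
  rewrite -[X in q ^+ X](card_ord m) -prodr_const -big_split /=.
  by apply: eq_bigr => i _; rewrite exprS; ring.
have h1 := qpochoo_neq0 q1 am; have h2 := qpoch_neq0 q1 m a1; have h3 := qpoch_neq0 q1 m.+1 q1.
by rewrite expr0; field; rewrite h1 h2 h3.
Qed.

End LogDerivative.

(** * The left-hand side and the functions frakS as power series in c *)

Section SeriesInC.
Variable R : realType.
Local Notation C := (complex R)^o.
Variable q : C.
Hypothesis q1 : cnorm q < 1.
Implicit Types (x y a c : C).

Lemma cnorm_mulq_expr (c : C) n : cnorm (c * q ^+ n.+1) <= cnorm (c * q).
Proof.
rewrite exprS mulrA cnormM cnormX ler_piMr ?cnorm_ge0//.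
by rewrite exprn_ile1 ?cnorm_ge0// ltW.
Qed.

Lemma lhs_termS k (a c : C) n :
  lhs_term k q a c n.+1 = (1 - c * q ^+ n.+1) ^- k.+1 * uterm q a n.+1.
Proof. by rewrite /lhs_term /uterm invfM mulrCA. Qed.

Lemma cvg_lhs k (a c : C) : cnorm a < 1 -> cnorm (c * q) < 1 ->
  cvgn (series1 (lhs_term k q a c)).
Proof.
move=> a1 cq1; apply: geo_cvg; under eq_fun do rewrite lhs_termS.
have B0 : 0 <= (1 - cnorm (c * q))^-1 by rewrite invr_ge0 subr_ge0 ltW.
apply: (geo_le (geo_uterm q1 a1) (exprn_ge0 k.+1 B0)) => n.
rewrite [leLHS]cnormM ler_wpM2r ?cnorm_ge0// -exprVn cnormX lerXn2r ?nnegrE ?cnorm_ge0//.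
by apply: cnorm_inv_subr1 => //; exact: cnorm_mulq_expr.
Qed.

Lemma geo_qbin_mulX (a c : C) : cnorm (c * q) < 1 -> geo (fun n => c ^+ n * qbin q q a n).
Proof.
move=> cq1; have := geo_qbin q1 (c * a) cq1.
by congr geo; apply/funext => n; rewrite qbin_scale.
Qed.

Lemma sum_lhs k (a c : C) : c != 0 -> cnorm a < 1 -> cnorm (c * q) < 1 ->
  sum1 (lhs_term k q a c) = - (qpochoo q q / qpochoo q a *
     tsum (fun m => 'C(m + k, k)%:R * (c ^+ m * qbin q q a m.+1))).
Proof.
move=> c0 a1 cq1.
have cqn n : cnorm (c * q ^+ n.+1) < 1 := le_lt_trans (cnorm_mulq_expr c n) cq1.
pose b n m := 'C(m + k, k)%:R * c ^+ m * (uterm q a n.+1 * (q ^+ n.+1) ^+ m).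
have -> : sum1 (lhs_term k q a c) = tsum (fun n => tsum (b n)).
  apply: eq_tsum => n; rewrite lhs_termS -tsum_negbin// mulrC -tsumZ; last first.
    by apply/geo_cvg/geo_bin/geo_expr.
  by apply: eq_tsum => m; rewrite /b exprMn; ring.
have [M [r [r0 r1 hu]]] := geo_uterm q1 a1.
have [M' [r' [r0' r1' hb]]] := geo_bin k (geo_expr cq1).
rewrite (@tsum_exchange _ b (M * M') r r')// => [|n m]; last first.
  (* The last factor has modulus at most 1; the other two decay geometrically in n and in m. *)
  have -> : b n m = uterm q a n.+1 * ('C(m + k, k)%:R * (c * q) ^+ m) * (q ^+ m) ^+ n.
    by rewrite /b exprMn exprS exprMn -!exprM [(m * n)%N]mulnC; ring.
  rewrite cnormM -[leRHS]mulr1 ler_pM ?cnorm_ge0//; last first.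
    by rewrite -exprM cnormX exprn_ile1 ?cnorm_ge0// ltW.
  rewrite cnormM (_ : M * M' * _ * _ = (M * r ^+ n) * (M' * r' ^+ m)); last by ring.
  by rewrite ler_pM ?cnorm_ge0.
rewrite -mulNr -tsumZ.
  apply: eq_tsum => m; rewrite /b tsumZ; last first.
    apply: geo_cvg; apply: (geo_le (geo_uterm q1 a1) ler01) => n.
    rewrite mul1r cnormM ler_piMr ?cnorm_ge0// -exprM cnormX exprn_ile1 ?cnorm_ge0//.
    exact: ltW.
  by rewrite tsum_uterm//; ring.
apply/geo_cvg/geo_bin.
have := geoZ c^-1 (geo_shift (geo_qbin_mulX a cq1)).
by under eq_fun do rewrite exprS -mulrA mulKf//.
Qed.

(* For k > 0 this is c times the series in [sum_lhs]; for k = 0 it is (ac)_oo / (cq)_oo. *)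
Definition gsum k (a c : C) : C := tsum (fun n => (mbin n k)%:R * (c ^+ n * qbin q q a n)).

Lemma gsum_shift k (a c : C) : (0 < k)%N -> cnorm (c * q) < 1 ->
  gsum k a c = c * tsum (fun m => 'C(m + k, k)%:R * (c ^+ m * qbin q q a m.+1)).
Proof.
move=> k0 cq1; rewrite /gsum tsum_recl; last exact/geo_cvg/geo_mbin/geo_qbin_mulX.
(* The term n = 0 vanishes because k > 0; for k = 0 it would be 1. *)
rewrite /mbin add0n bin_small ?prednK// mul0r add0r.
have [->|c0] := eqVneq c 0.
  rewrite mul0r (@tsum_finite _ _ 0%N) ?big_ord0// => n _.
  by rewrite exprS !mul0r mulr0.
rewrite -tsumZ; last first.
  apply/geo_cvg/geo_bin; have := geoZ c^-1 (geo_shift (geo_qbin_mulX a cq1)).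
  by under eq_fun do rewrite exprS -mulrA mulKf//.
by apply: eq_tsum => m; rewrite addSn exprS /=; ring.
Qed.

Lemma gsum0 (a c : C) : cnorm (a * c) < 1 -> cnorm (c * q) < 1 ->
  gsum 0 a c = qpochoo q (a * c) / qpochoo q (c * q).
Proof.
move=> ac1 cq1; rewrite -qbsumE//; apply: eq_tsum => n.
by rewrite /mbin bin0 mul1r [a * c]mulrC qbin_scale.
Qed.

Lemma cnorm_inv_subr1q n : cnorm (1 - q ^+ n.+1)^-1 <= (1 - cnorm q)^-1.
Proof.
apply: cnorm_inv_subr1 => //.
by have := cnorm_mulq_expr 1 n; rewrite !mul1r.
Qed.

Lemma geo_divq (x : C) : cnorm x < 1 -> geo (fun n => x ^+ n.+1 / (1 - q ^+ n.+1)).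
Proof.
move=> x1; have B0 : 0 <= (1 - cnorm q)^-1 by rewrite invr_ge0 subr_ge0 ltW.
apply: (geo_le (geo_shift (geo_expr x1)) B0) => n.
by rewrite cnormM mulrC ler_wpM2r ?cnorm_ge0// cnorm_inv_subr1q.
Qed.

(** The polylogarithm completes the second series: a^n + a^n q^n / (1 - q^n) = a^n / (1 - q^n). *)
Lemma frakS_tsum m (a c : C) : cnorm (a * c) < 1 -> cnorm (c * q) < 1 ->
  frakS m a c q = tsum (fun n => n.+1%:R ^+ m * (c ^+ n.+1 * ldcoef q a n.+1)).
Proof.
move=> ac1 cq1.
have acq1 : cnorm (a * c * q) < 1 by have := cnorm_expr_lt1 q1 1 ac1.
have g1 := geo_natmulX m (geo_divq cq1).
have g2 := geo_natmulX m (geo_shift (geo_expr ac1)).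
have g3 := geo_natmulX m (geo_divq acq1).
transitivity (tsum (fun n => n.+1%:R ^+ m * ((c * q) ^+ n.+1 / (1 - q ^+ n.+1))) -
  (tsum (fun n => n.+1%:R ^+ m * (a * c) ^+ n.+1) +
   tsum (fun n => n.+1%:R ^+ m * ((a * c * q) ^+ n.+1 / (1 - q ^+ n.+1))))).
  congr (_ - (_ + _)).
    by apply: eq_tsum => n; rewrite exprMn !mulrA.
  by apply: eq_tsum => n; rewrite !exprMn !mulrA.
rewrite -tsumD; [|exact: geo_cvg..].
rewrite -tsumB; [|exact: geo_cvg|exact/geo_cvg/geoD].
apply: eq_tsum => n; rewrite /ldcoef !exprMn.
have h1 := qq_neq0 q1 n.
by set Q := q ^+ n.+1 in h1 *; field.
Qed.

Lemma geo_ldcoef (a c : C) : cnorm (a * c) < 1 -> cnorm (c * q) < 1 ->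
  geo (fun n => c ^+ n.+1 * ldcoef q a n.+1).
Proof.
move=> ac1 cq1; have := geoB (geo_divq cq1) (geo_divq ac1).
congr geo; apply/funext => n.
by rewrite -mulrBl /ldcoef !exprMn [a ^+ _ * _]mulrC -mulrBr mulrA.
Qed.

(** The coefficient of t^j in F'(t) / F(t) for F(t) = G(c / (1 - t)). The chain rule contributes one
    more factor 1 / (1 - t), hence the exponent n + 2 at c^(n + 1). *)
Definition ysum j (a c : C) : C :=
  tsum (fun n => (mbin n.+2 j)%:R * (c ^+ n.+1 * ldcoef q a n.+1)).

(* The coefficient of t^k in F'(t) = (F'(t) / F(t)) F(t),
   where F(t) = G(c / (1 - t)) = \sum_k gsum k t^k. *)
Lemma gsum_rec k (a c : C) : cnorm (a * c) < 1 -> cnorm (c * q) < 1 ->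
  k.+1%:R * gsum k.+1 a c = \sum_(j < k.+1) ysum j a c * gsum (k - j) a c.
Proof.
move=> ac1 cq1; have gg := geo_qbin_mulX a cq1; have gl := geo_ldcoef ac1 cq1.
have gy j : geo (fun n => (mbin n.+2 j)%:R * (c ^+ n.+1 * ldcoef q a n.+1)).
  have B0 : 0 <= (2 ^ j)%:R :> R by [].
  apply: (geo_le (geo_natmulX j gl) B0) => n.
  set v := c ^+ n.+1 * _; rewrite !(cnormM _ v) cnormX !cnorm_nat.
  rewrite mulrA ler_wpM2r ?cnorm_ge0// -natrX -natrM ler_nat.
  exact: mbin_shift_le.
have gm j : geo (fun n => (mbin n j)%:R * (c ^+ n * qbin q q a n)) by exact: geo_mbin.
rewrite /gsum /ysum.
under eq_bigr do rewrite -tsum_conv//.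
rewrite -(@tsum_sum _ (fun j => conv (fun n => (mbin n.+2 j)%:R * (c ^+ n.+1 * ldcoef q a n.+1))
   (fun n => (mbin n (k - j))%:R * (c ^+ n * qbin q q a n)))); last first.
  by move=> j; apply/cvg_ex; eexists; exact: cvg_conv.
rewrite -tsumZ; last exact: geo_cvg.
rewrite tsum_recl; last exact/geo_cvg/geoZ.
rewrite {1}/mbin add0n bin_small// mul0r mulr0 add0r.
apply: eq_tsum => n; rewrite /conv exchange_big /=.
transitivity ((mbin n.+2 k)%:R * c ^+ n.+1 * (n.+1%:R * qbin q q a n.+1)).
  (* Absorption trades k + 1 for n + 1, which makes the coefficient of c G'(c) appear. *)
  rewrite mulrA -natrM; have -> : (k.+1 * mbin n.+1 k.+1 = mbin n.+2 k * n.+1)%N.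
    have -> : mbin n.+1 k.+1 = 'C(n.+1 + k, k.+1) by rewrite /mbin !addSn addnS.
    by rewrite mul_bin_left addnK mulnC.
  by rewrite natrM; ring.
rewrite -conv_ldcoef// /conv mulr_sumr; apply: eq_bigr => i _.
have iN : (i <= n)%N by rewrite -ltnS.
(* The exponents of 1 / (1 - t) in F' / F and in F add up, so [mbin_conv] applies. *)
have -> : n.+2 = (i.+2 + (n - i))%N by rewrite !addSn subnKC.
rewrite -mbin_conv natr_sum !mulr_suml; apply: eq_bigr => j _.
rewrite natrM (_ : c ^+ n.+1 = c ^+ i.+1 * c ^+ (n - i)); last by rewrite -exprD addSn subnKC.
ring.
Qed.

End SeriesInC.

(** * Binomial coefficients as rational polynomials *)

Section BinomialPolynomial.

Definition binpoly j : {poly rat} := \prod_(i < j) ((i.+1%:R)^-1 *: ('X + (i.+1%:R)%:P)).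

Lemma size_binpoly j : (size (binpoly j) <= j.+1)%N.
Proof.
elim: j => [|j IH]; first by rewrite /binpoly big_ord0 size_poly1.
rewrite /binpoly big_ord_recr /= (leq_trans (size_polyMleq _ _))//.
have h : (size (j.+1%:R^-1 *: ('X + j.+1%:R%:P) : {poly rat}) <= 2)%N.
  by rewrite (leq_trans (size_scale_leq _ _))// size_XaddC.
by rewrite -subn1 leq_subLR (leq_trans (leq_add IH h))// addn2 add1n.
Qed.

Lemma horner_binpoly (F : numFieldType) j m :
  (map_poly (ratr : rat -> F) (binpoly j)).[m%:R] = 'C(m + j, j)%:R.
Proof.
elim: j => [|j IH]; first by rewrite /binpoly big_ord0 rmorph1 hornerC bin0.
have j0 : j.+1%:R != 0 :> F by rewrite pnatr_eq0.
rewrite /binpoly big_ord_recr rmorphM /= hornerM -/(binpoly j) IH map_polyZ hornerZ.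
rewrite rmorphD /= map_polyX map_polyC hornerD hornerX hornerC fmorphV /= !ratr_nat.
apply: (mulfI j0); rewrite [LHS]mulrCA mulVKf// -!natrD -!natrM.
by rewrite addnS -mul_bin_diag mulnC.
Qed.

End BinomialPolynomial.

(** * The polynomials P_k and the restriction to |a| < 1 *)

Section RationalPolynomials.
Import -(notations) mpoly.
Variable R : realType.
Local Notation C := (complex R)^o.
Implicit Types (q a c : C).

Lemma evalQM k (P Q : mpoly.mpoly k rat) (v : 'I_k -> C) : evalQ (P * Q) v = evalQ P v * evalQ Q v.
Proof. exact: (rmorphM (mpoly.mmap _ v)). Qed.

Lemma evalQZ k x (P : mpoly.mpoly k rat) (v : 'I_k -> C) : evalQ (x *: P) v = ratr x * evalQ P v.
Proof. exact: mpoly.mmapZ. Qed.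

Lemma evalQ1 k (v : 'I_k -> C) : evalQ 1 v = 1.
Proof. exact: (rmorph1 (mpoly.mmap _ v)). Qed.

Lemma evalQ_sum k I (r : seq I) (F : I -> mpoly.mpoly k rat) (v : 'I_k -> C) :
  evalQ (\sum_(i <- r) F i) v = \sum_(i <- r) evalQ (F i) v.
Proof. exact: (raddf_sum (mpoly.mmap _ v)). Qed.

Lemma evalQX k i (v : 'I_k -> C) : evalQ (mpoly.mpolyX _ (mpoly.mnm1 i)) v = v i.
Proof. by rewrite /evalQ mpoly.mmapX mpoly.mmap1U. Qed.

(** The binomial weight is [binpoly j] at n + 1; its degree is at most j < k, so the powers below k
    suffice. *)
Lemma ysum_frakS k j q a c : (j < k)%N -> cnorm q < 1 -> cnorm (a * c) < 1 -> cnorm (c * q) < 1 ->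
  ysum q j a c = \sum_(i < k) ratr (binpoly j)`_i * frakS i a c q.
Proof.
move=> jk q1 ac1 cq1; have gl := geo_ldcoef q1 ac1 cq1.
transitivity (\sum_(i < k) tsum (fun n => ratr (binpoly j)`_i *
   (n.+1%:R ^+ i * (c ^+ n.+1 * ldcoef q a n.+1)))); last first.
  apply: eq_bigr => i _; rewrite frakS_tsum// tsumZ//.
  exact/geo_cvg/geo_natmulX.
rewrite -(@tsum_sum _ (fun i n => ratr (binpoly j)`_i *
   (n.+1%:R ^+ i * (c ^+ n.+1 * ldcoef q a n.+1)))); last first.
  by move=> i; exact/geo_cvg/geoZ/geo_natmulX.
apply: eq_tsum => n; rewrite mbin_addr -horner_binpoly.
rewrite (@horner_coef_wide _ k); last first.
  by rewrite (leq_trans (size_poly _ _))// (leq_trans (size_binpoly j)).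
rewrite mulr_suml; apply: eq_bigr => i _.
by rewrite coef_map /= -mulrA.
Qed.

(** The linear form taking the value Y_j at frakS_0, ..., frakS_(k-1) when j < k. *)
Definition ypoly k j : mpoly.mpoly k rat :=
  \sum_(i < k) (binpoly j)`_i *: mpoly.mpolyX _ (mpoly.mnm1 i).

(** P_0, ..., P_j are carried together, since [gsum_rec] involves all of them. They are chosen
    before q, a and c, and j <= k keeps every Y_l within k variables. *)
Lemma gsum_poly k j : (j <= k)%N -> exists P : nat -> mpoly.mpoly k rat,
  forall i, (i <= j)%N -> forall q a c, cnorm q < 1 -> cnorm (a * c) < 1 -> cnorm (c * q) < 1 ->
  gsum q i a c = gsum q 0 a c * evalQ (P i) (fun i : 'I_k => frakS i a c q).
Proof.
elim: j => [|j IH] jk.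
  exists (fun=> 1) => i; rewrite leqn0 => /eqP -> q a c q1 ac1 cq1.
  by rewrite evalQ1 mulr1.
have [P hP] := IH (ltnW jk).
exists (fun i => if (i <= j)%N then P i else
  (j.+1%:R)^-1 *: \sum_(l < j.+1) ypoly k l * P (j - l)%N).
move=> i ij q a c q1 ac1 cq1; case: leqP => [|ji]; first by move=> ?; exact: hP.
have -> : i = j.+1 by apply/eqP; rewrite eqn_leq ij.
have j0 : j.+1%:R != 0 :> C by rewrite pnatr_eq0.
apply: (mulfI j0); rewrite gsum_rec// evalQZ fmorphV /= ratr_nat mulrCA mulVKf//.
rewrite evalQ_sum mulr_sumr; apply: eq_bigr => l _.
rewrite (hP (j - l)%N (leq_subr _ _))// evalQM mulrCA; congr (_ * (_ * _)).
rewrite (@ysum_frakS k)//; last by apply: leq_trans jk; exact: ltn_ord.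
by rewrite evalQ_sum; apply: eq_bigr => m _; rewrite evalQZ evalQX.
Qed.

(* For |a| >= 1 the vanishing of the terms would force (q/a)_oo = 0. *)
Lemma cvg_lhs_cnorm k q a c : cnorm q < 1 -> cnorm (c * q) < 1 ->
  cvgn (series1 (lhs_term k q a c)) -> cnorm a < 1.
Proof.
move=> q1 cq1 /cvg_series_cvg_0 h0; rewrite ltNge; apply/negP => a1.
have a0 : a != 0.
  by apply/eqP => a0; move: a1; rewrite a0 cnorm0 ler10.
have qa1 : cnorm (q / a) < 1.
  by rewrite cnormM cnormV ltr_pdivrMr ?mul1r ?(lt_le_trans q1)// (lt_le_trans _ a1).
have cqn : (fun n => c * q ^+ n.+1) @ \oo --> (0 : C).
  rewrite -(mulr0 c); apply: cvgM; first exact: cvg_cst.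
  by apply/(cvg_shift _ _ 1%N); exact: cvg_exprq.
have h1' : (fun n => 1 - c * q ^+ n.+1) @ \oo --> (1 : C).
  by rewrite -[X in _ --> X]subr0; apply: cvgB; [exact: cvg_cst | exact: cqn].
have h1 : (fun n => (1 - c * q ^+ n.+1) ^+ k.+1) @ \oo --> (1 : C).
  elim: k.+1 => [|m IH]; first by under eq_fun do rewrite expr0; exact: cvg_cst.
  rewrite [X in X @ _ --> _](_ : _ = (fun n => 1 - c * q ^+ n.+1) \*
    (fun n => (1 - c * q ^+ n.+1) ^+ m)); last by apply/funext => n; rewrite exprS.
  by rewrite -[X in _ --> X]mul1r; exact: (cvgM h1' IH).
(* The denominators converge, so clearing them leaves (q/a)_(n+1) a^(n+1) tending to 0. *)
have h2 : (fun n => lhs_term k q a c n.+1 *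
    ((1 - c * q ^+ n.+1) ^+ k.+1 * qpoch q q n)) @ \oo --> (0 : C).
  rewrite -(mul0r (1 * qpochoo q q)); apply: cvgM; first exact: h0.
  by apply: cvgM; [exact: h1 | exact: cvg_qpoch].
(* Since |a| >= 1, dropping the power of a only decreases the modulus. *)
have h3 : (fun n => qpoch q (q / a) n.+1) @ \oo --> (0 : C).
  apply: cvg_cnorm0; move/cvg_cnorm: h2.
  under eq_fun do rewrite subr0.
  move=> h2; apply: (squeeze_cvgr _ (@cvg_cst _ _ _ _ _) h2); apply: nearW => n.
  rewrite cnorm_ge0 /lhs_term /qpoch_div (negbTE a0) divfK; last first.
    rewrite mulf_neq0 ?qpoch_neq0// expf_neq0// subr1_neq0//.
    exact: le_lt_trans (cnorm_mulq_expr q1 c n) cq1.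
  by rewrite cnormM cnormX ler_peMr ?cnorm_ge0// exprn_ege1.
apply/negP: (qpochoo_neq0 q1 qa1); rewrite negbK; apply/eqP/cvgC_lim.
by apply/(cvg_shift _ _ 1%N); exact: h3.
Qed.

End RationalPolynomials.

Theorem theorem2p10 (R : realType) (k : nat) (hk : (0 < k)%N) :
  exists P : mpoly.mpoly k rat,
    forall q a c : CC R,
      `|q| < 1 -> c != 0 -> `|a * c| < 1 -> `|c * q| < 1 ->
      (`|a| < 1 -> cvgn (series1 (lhs_term k q a c))) /\
      (cvgn (series1 (lhs_term k q a c)) ->
       sum1 (lhs_term k q a c) =
       - (1 / c) * (qpochoo q q * qpochoo q (a * c)
                    / (qpochoo q (c * q) * qpochoo q a))
       * evalQ P (fun i : 'I_k => frakS i a c q)).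
Proof.
have [P hP] := gsum_poly R (leqnn k).
exists (P k) => q a c; rewrite !normC_lt1 => q1 c0 ac1 cq1; split=> [a1|cv].
  exact: cvg_lhs.
have a1 := cvg_lhs_cnorm q1 cq1 cv.
rewrite sum_lhs//; have := gsum_shift q1 a hk cq1.
rewrite (hP k (leqnn k))// gsum0// => hg.
(* The series in [sum_lhs] is 1 / c times [gsum q k a c], whence the factor 1 / c. *)
rewrite -[X in - (_ * X)](mulKf c0) -hg.
by rewrite invfM mul1r mulNr mulNr; congr (- _); ring.
Qed.
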